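(* Let $(V,g)$ be a Euclidean real vector space of finite dimension $n\ge 1$ and let $h$ be a symmetric bilinear form on $V$. Let $i,r$ be integers with $1\le i+1\le r\le n-i$. Then $$s_{(r,n-i)}(h)=0,$$ where, for integers $q\geq 1$, $r\ge 1$, $$s_{(r,q)}(h)=\sum_{j=\max\{0,q-r\}}^{q}\frac{(-1)^{j+q}}{j!\,q!\,(j+r-q)!}\,g^{j+r-q}\,\mathrm{c}^{j}(h^{q}),$$ $\mathrm{c}$ is the contraction map on double forms, and all products and powers are exterior products of double forms.
   Context: Let $(V,g)$ be a Euclidean real vector space of dimension $n$. A $(p,q)$ double form is an element of $\mathcal D^{p,q}=\Lambda^pV^*\otimes\Lambda^qV^*$, identified with a bilinear form $\Lambda^pV\times\Lambda^qV\to\mathbb R$. Exterior product: $(\theta_1\otimes\theta_2)(\theta_3\otimes\theta_4)=(\theta_1\wedge\theta_3)\otimes(\theta_2\wedge\theta_4)$, extended bilinearly; powers are taken for this product, with zeroth power $1$. Bilinear forms on $V$ (in particular $g,h$) are regarded as $(1,1)$ double forms; one has $h^k(x_1\wedge\dots\wedge x_k,y_1\wedge\dots\wedge y_k)=k!\det[h(x_a,y_b)]$. Contraction $\mathrm c:\mathcal D^{p,q}\to\mathcal D^{p-1,q-1}$ ($p,q\ge1$): $\mathrm c\,\omega(x_1\wedge\dots\wedge x_{p-1},y_1\wedge\dots\wedge y_{q-1})=\sum_{j=1}^n\omega(e_j\wedge x_1\wedge\dots\wedge x_{p-1},e_j\wedge y_1\wedge\dots\wedge y_{q-1})$ for any orthonormal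 basis $(e_j)$ of $V$; $\mathrm c^j$ is the $j$-fold iterate. Background: for $q+r\le n$ the quantity $s_{(r,q)}(h)$ equals $\frac{1}{q!(n-q-r)!}*(g^{n-q-r}h^q)$ with $*$ the double Hodge star; the displayed sum is used as the definition of $s_{(r,q)}(h)$ when $q+r>n$, which is the case in the claim. *)

(* Defs.v *)
From HB Require Import structures.
From mathcomp Require Import all_boot all_order all_algebra.
From mathcomp Require Import boolp functions reals.

Set Implicit Arguments.
Unset Strict Implicit.
Unset Printing Implicit Defensive.
Import Order.TTheory GRing.Theory Num.Theory.
Local Open Scope ring_scope.

Section OneSided.
Context {R : realType} {V : vectType R}.
Implicit Types (x y u v : V) (xs ys A B : seq V) (f : seq V -> R).
Implicit Types F G : seq V -> seq V -> R.

Definition multilinear f := forall A B (k : R) u v,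
  f (A ++ (k *: u + v) :: B) = k * f (A ++ u :: B) + f (A ++ v :: B).

Definition alternating f := forall xs, ~~ uniq xs -> f xs = 0.

(* The sum of sgn * F (x_i)_{i in I} (x_i)_{i notin I} over all sets I of
   positions of xs, where sgn is the sign of the permutation listing I in
   increasing order and then its complement in increasing order.  The first
   vector x of xs goes either to the left block, at no cost, or to the right
   one, past the size a vectors of the left block. *)
Fixpoint shuffle F xs : R :=
  if xs is x :: xs' then
    shuffle (fun a b => F (x :: a) b) xs'
    + shuffle (fun a b => (-1) ^+ size a * F a (x :: b)) xs'
  else F [::] [::].

Lemma eq_shuffle F G xs : (forall a b, F a b = G a b) ->
  shuffle F xs = shuffle G xs.
Proof.
elim: xs F G => [|x xs IH] F G FG /=; first exact: FG.
by congr (_ + _); apply: IH => a b; rewrite FG.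
Qed.

Lemma shuffle0 F xs : (forall a b, F a b = 0) -> shuffle F xs = 0.
Proof.
elim: xs F => [|x xs IH] F F0 /=; first exact: F0.
by rewrite !IH ?addr0 // => a b; rewrite F0 ?mulr0.
Qed.

Lemma shuffle_lin (k : R) F G xs :
  shuffle (fun a b => k * F a b + G a b) xs = k * shuffle F xs + shuffle G xs.
Proof.
elim: xs F G => [|x xs IH] F G //=.
rewrite IH [X in _ + X = _](eq_shuffle (G := fun a b =>
  k * ((-1) ^+ size a * F a (x :: b)) + (-1) ^+ size a * G a (x :: b)));
  last first.
  by move=> a b /=; rewrite mulrDr mulrCA.
by rewrite IH mulrDr addrACA.
Qed.

Definition multilinear2 F :=
  (forall b, multilinear (F^~ b)) /\ (forall a, multilinear (F a)).

Definition alternating2 F :=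
  (forall b, alternating (F^~ b)) /\ (forall a, alternating (F a)).

Lemma multilinear2_l F x :
  multilinear2 F -> multilinear2 (fun a b => F (x :: a) b).
Proof.
by move=> [Fl Fr]; split=> [b A B k u v|a]; [exact: (Fl b (x :: A))|].
Qed.

Lemma multilinear2_r F x :
  multilinear2 F -> multilinear2 (fun a b => (-1) ^+ size a * F a (x :: b)).
Proof.
move=> [Fl Fr]; split=> [b|a] A B k u v /=.
  by rewrite Fl !size_cat /= mulrDr mulrCA.
by rewrite (Fr a (x :: A)) /= mulrDr mulrCA.
Qed.

Lemma alternating2_l F x :
  alternating2 F -> alternating2 (fun a b => F (x :: a) b).
Proof.
move=> [Fl Fr]; split=> [b xs xsN|a xs xsN]; last exact: Fr.
by apply: Fl; rewrite /= negb_and xsN orbT.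
Qed.

Lemma alternating2_r F x :
  alternating2 F -> alternating2 (fun a b => (-1) ^+ size a * F a (x :: b)).
Proof.
move=> [Fl Fr]; split=> [b xs xsN|a xs xsN]; first by rewrite Fl ?mulr0.
by rewrite Fr ?mulr0 //= negb_and xsN orbT.
Qed.

Lemma shuffle_multilinear F : multilinear2 F -> multilinear (shuffle F).
Proof.
move=> mF A; elim: A F mF => [|x A IH] F mF B k u v /=; last first.
  rewrite (IH _ (multilinear2_l x mF)) (IH _ (multilinear2_r x mF)).
  by rewrite mulrDr addrACA.
rewrite (eq_shuffle (G := fun a b => k * F (u :: a) b + F (v :: a) b));
  last first.
  by move=> a b; apply: (mF.1 b [::]).
rewrite [X in _ + X](eq_shuffle (G := fun a b =>
  k * ((-1) ^+ size a * F a (u :: b)) + (-1) ^+ size a * F a (v :: b)));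
  last first.
  by move=> a b; rewrite (mF.2 a [::]) /= mulrDr mulrCA.
by rewrite !shuffle_lin mulrDr addrACA.
Qed.

Lemma adjacent_alternating f : multilinear f ->
  (forall A B x, f (A ++ x :: x :: B) = 0) -> alternating f.
Proof.
move=> mf f0.
have f_add A B u v : f (A ++ (u + v) :: B) = f (A ++ u :: B) + f (A ++ v :: B).
  by have := mf A B 1 u v; rewrite scale1r mul1r.
have anti A B x y : f (A ++ x :: y :: B) = - f (A ++ y :: x :: B).
  have := f0 A B (x + y); rewrite f_add -!(cat_rcons _ A) !f_add.
  rewrite !cat_rcons !f0 add0r addr0 => /eqP.
  by rewrite addr_eq0 => /eqP.
have far A B C x : f (A ++ x :: B ++ x :: C) = 0.
  elim: B A => [|y B IH] A /=; first exact: f0.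
  by rewrite anti -cat_rcons IH oppr0.
move=> xs; rewrite -[xs in f xs]/([::] ++ xs); move: {1}[::] => A.
elim: xs A => //= x xs IH A; rewrite negb_and negbK => /orP[|xsN].
  by case/splitPr=> B C; apply: far.
by rewrite -cat_rcons IH.
Qed.

Lemma shuffle_alternating F :
  multilinear2 F -> alternating2 F -> alternating (shuffle F).
Proof.
move=> mF aF; apply: adjacent_alternating; first exact: shuffle_multilinear.
move=> A B x; elim: A F mF aF => [|y A IH] F mF aF /=; last first.
  rewrite (IH _ (multilinear2_l y mF) (alternating2_l y aF)).
  by rewrite (IH _ (multilinear2_r y mF) (alternating2_r y aF)) addr0.
rewrite shuffle0; last first.
  by move=> a b; rewrite (aF.1 b) //= inE eqxx.
rewrite [X in _ + (_ + X)]shuffle0; last first.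
  by move=> a b; rewrite (aF.2 a) ?mulr0 //= inE eqxx.
rewrite add0r addr0 addrC.
rewrite (eq_shuffle (G := fun a b => -1 * ((-1) ^+ size a * F (x :: a) (x :: b))
  + 0)); last by move=> a b; rewrite addr0 exprS mulrA.
by rewrite shuffle_lin [X in _ + X + _]shuffle0 // addr0 mulN1r addNr.
Qed.

End OneSided.

Section DoubleForms.
Context {R : realType} {V : vectType R}.
Implicit Types (x y u v e : V) (xs ys : seq V).
Local Notation map2 := (seq V -> seq V -> R^o).
Implicit Types w t : map2.

(* A double form is encoded as a family of functions of two lists of vectors:
   w [:: x_1; ...; x_p] [:: y_1; ...; y_q] is the value of its (p, q) component
   at (x_1 /\ ... /\ x_p, y_1 /\ ... /\ y_q).  As V is finite-dimensional,
   alternating maps in more than \dim V vectors vanish, so that these families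
   form the direct sum of all the D^{p,q}. *)
Definition is_dform w : Prop :=
  [/\ forall ys, multilinear (w^~ ys : seq V -> R),
      forall xs, multilinear (w xs : seq V -> R),
      forall ys, alternating (w^~ ys : seq V -> R)
    & forall xs, alternating (w xs : seq V -> R)].

Definition dform_pred : {pred map2} := fun w => `[< is_dform w >].

Lemma dform_submod_closed : GRing.submod_closed dform_pred.
Proof.
split=> [|k w t].
  apply/asboolP; split=> // *; first by move=> A B k u v; rewrite mulr0 addr0.
  by move=> A B k u v; rewrite mulr0 addr0.
move=> /asboolP[w1 w2 w3 w4] /asboolP[t1 t2 t3 t4]; apply/asboolP.
have E xs ys : (k *: w + t) xs ys = k * w xs ys + t xs ys by [].
split=> [ys A B c u v|xs A B c u v|ys xs xsN|xs ys ysN]; rewrite !E.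
- by rewrite w1 t1 !mulrDr mulrCA addrACA.
- by rewrite w2 t2 !mulrDr mulrCA addrACA.
- by rewrite w3 // t3 // mulr0 addr0.
- by rewrite w4 // t4 // mulr0 addr0.
Qed.

HB.instance Definition _ :=
  GRing.isSubmodClosed.Build R map2 dform_pred dform_submod_closed.

Record dform : Type := DForm {
  dform_val :> map2;
  dform_valP : dform_val \in dform_pred }.

HB.instance Definition _ := [isSub for dform_val].
HB.instance Definition _ := [Choice of dform by <:].
HB.instance Definition _ := [SubChoice_isSubLmodule of dform by <:].

Lemma dformP (w : dform) : is_dform w.
Proof. exact/asboolP/dform_valP. Qed.

Definition one_fun : map2 :=
  fun xs ys => if (xs, ys) is ([::], [::]) then 1 else 0.

Lemma one_fun_dform : one_fun \in dform_pred.
Proof.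
apply/asboolP; rewrite /one_fun.
split=> [ys [|? ?] B c u v|[|? ?] [|? ?] B c u v|ys [|? ?]|[|? ?] [|? ?]] //=;
  by rewrite ?mulr0 ?addr0.
Qed.

Definition dform_one : dform := DForm one_fun_dform.

Definition bilin_fun (b : {symmetric V}) : map2 :=
  fun xs ys => if (xs, ys) is ([:: x], [:: y]) then b x y else 0.

Lemma bilin_fun_dform b : bilin_fun b \in dform_pred.
Proof.
apply/asboolP; rewrite /bilin_fun.
split.
- move=> [|y [|? ?]] [|x [|? ?]] [|? ?] c u v //=; rewrite ?mulr0 ?addr0 //.
  by rewrite linearPl.
- move=> [|x [|? ?]] [|y [|? ?]] [|? ?] c u v //=; rewrite ?mulr0 ?addr0 //.
  by rewrite linearPr.
- by move=> [|y [|? ?]] [|x [|? ?]].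
- by move=> [|x [|? ?]] [|y [|? ?]].
Qed.

Definition dform_of (b : {symmetric V}) : dform := DForm (bilin_fun_dform b).

Definition exterior_fun w t : map2 := fun xs ys =>
  shuffle (fun a c => shuffle (fun b d => w a b * t c d) ys) xs.

Lemma exterior_fun_dform (w t : dform) : exterior_fun w t \in dform_pred.
Proof.
have [w1 w2 w3 w4] := dformP w; have [t1 t2 t3 t4] := dformP t.
have mr a c : multilinear2 (fun b d => w a b * t c d : R).
  split=> [d|b] A B k u v /=; first by rewrite w2 mulrDl mulrA.
  by rewrite t2 mulrDr mulrCA.
have ar a c : alternating2 (fun b d => w a b * t c d : R).
  split=> [d|b] A AN /=; first by rewrite w4 ?mul0r.
  by rewrite t4 ?mulr0.
have ml ys : multilinear2 (fun a c => shuffle (fun b d => w a b * t c d) ys).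
  split=> [c|a] A B k u v; rewrite -shuffle_lin; apply: eq_shuffle => b d.
    by rewrite w1 mulrDl mulrA.
  by rewrite t1 mulrDr mulrCA.
have al ys : alternating2 (fun a c => shuffle (fun b d => w a b * t c d) ys).
  split=> [c|a] A AN; apply: shuffle0 => b d; first by rewrite w3 ?mul0r.
  by rewrite t3 ?mulr0.
apply/asboolP; split=> [ys|xs|ys|xs].
- exact: shuffle_multilinear.
- move=> A B k u v; rewrite /exterior_fun -shuffle_lin; apply: eq_shuffle => a c.
  exact: shuffle_multilinear.
- exact: shuffle_alternating.
- move=> ys ysN; apply: shuffle0 => a c; exact: shuffle_alternating.
Qed.

Definition dform_mul (w t : dform) : dform := DForm (exterior_fun_dform w t).

Definition dform_exp (w : dform) (k : nat) : dform :=
  iter k (dform_mul w) dform_one.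

Definition contr_fun n (e : n.-tuple V) w : map2 := fun xs ys =>
  \sum_(j < n) w (tnth e j :: xs) (tnth e j :: ys).

Lemma contr_fun_dform n (e : n.-tuple V) (w : dform) :
  contr_fun e w \in dform_pred.
Proof.
have [w1 w2 w3 w4] := dformP w; apply/asboolP; rewrite /contr_fun.
split=> [ys A B k u v|xs A B k u v|ys xs xsN|xs ys ysN].
- rewrite mulr_sumr -big_split; apply: eq_bigr => j _ /=.
  exact: (w1 _ (_ :: _)).
- rewrite mulr_sumr -big_split; apply: eq_bigr => j _ /=.
  exact: (w2 _ (_ :: _)).
- by rewrite big1 // => j _; rewrite w3 //= negb_and xsN orbT.
- by rewrite big1 // => j _; rewrite w4 //= negb_and ysN orbT.
Qed.

(* The basis e is meant to be orthonormal. *)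
Definition contraction n (e : n.-tuple V) (w : dform) : dform :=
  DForm (contr_fun_dform e w).

(* The natural-number subtraction q - r truncates, hence is max {0, q - r}. *)
Definition s_form n (e : n.-tuple V) (g h : {symmetric V}) (r q : nat) :
  dform :=
  \sum_(q - r <= j < q.+1)
    ((-1) ^+ (j + q) / (j`! * q`! * (j + r - q)`!)%:R) *:
      dform_mul (dform_exp (dform_of g) (j + r - q))
                (iter j (contraction e) (dform_exp (dform_of h) q)).

End DoubleForms.

Arguments dform {R} V.

(* Main.v *)
(* The vanishing holds for every (q,q) double form w in place of h^q as soon as
   n < q + r.  Evaluate at (e_Z /\ e_U, e_Z /\ e_W), where (e_j) is orthonormal
   and Z, U, W are disjoint sets of indices, and write f X for the value of w at
   (e_X /\ e_U, e_X /\ e_W).  On such functions of X, multiplication by g sums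
   over the removal of one index and contraction sums over the insertion of one,
   so that g^p c^j w takes at Z the value
     p! j! sum_{Y in Z, |Y| = |Z| - p} sum_{X containing Y, |X| = |Y| + j} f X.
   Hence the coefficient of f X in s_(r,q) is, up to a factor independent of X,
   the sum of (-1)^|Y| over all Y contained in X :&: Z.  It is zero unless X and
   Z are disjoint, and then X, Z, U, W would be disjoint subsets of an n-element
   set with |X| + |W| = q and |Z| + |U| = r, contradicting n < q + r. *)
Require Import Defs.
From mathcomp Require Import all_boot all_order all_algebra.
From mathcomp Require Import reals.
From mathcomp Require Import zify ring boolp.

Set Implicit Arguments.
Unset Strict Implicit.
Unset Printing Implicit Defensive.
Import GRing.Theory Num.Theory.
Local Open Scope ring_scope.

(** * Reindexing and expansion of signed shuffle sums *)

Section Shuffle.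
Context {R : realType} {V : vectType R}.
Implicit Types (x y : V) (xs ys a b c d : seq V) (f : seq V -> R).
Implicit Types F G : seq V -> seq V -> R.

Lemma eq_shuffle_size F G xs :
  (forall a b, (size a + size b)%N = size xs -> F a b = G a b) ->
  shuffle F xs = shuffle G xs.
Proof.
elim: xs F G => [|x xs IH] F G FG /=; first exact: FG.
congr (_ + _); apply: IH => a b ab; first by rewrite FG //= addSn ab.
by rewrite FG //= addnS ab.
Qed.

Lemma shuffleD F G xs :
  shuffle (fun a b => F a b + G a b) xs = shuffle F xs + shuffle G xs.
Proof.
rewrite -[shuffle F xs]mul1r -shuffle_lin.
by apply: eq_shuffle => a b; rewrite mul1r.
Qed.

Lemma shuffleZ (k : R) F xs :
  shuffle (fun a b => k * F a b) xs = k * shuffle F xs.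
Proof.
rewrite -[RHS]addr0 -[in RHS](@shuffle0 _ _ (fun _ _ : seq V => 0) xs) //.
by rewrite -shuffle_lin; apply: eq_shuffle => a b; rewrite addr0.
Qed.

Lemma shuffle_exchange (T : seq V -> seq V -> seq V -> seq V -> R) xs ys :
  shuffle (fun a b => shuffle (T a b) ys) xs =
  shuffle (fun c d => shuffle (fun a b => T a b c d) xs) ys.
Proof.
elim: xs T => [//|x xs IH] T /=.
rewrite shuffleD -!IH; congr (_ + _).
by apply: eq_shuffle => a b; rewrite -shuffleZ.
Qed.

(** Each side sums over the splittings of [xs] into three blocks. A vector sent to the third block
    passes the first two, together on the left-hand side and one after the other on the right-hand
    side; the signs agree because [size s] is [size a + size b]. *)
Lemma shuffleA (T : seq V -> seq V -> seq V -> R) xs :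
  shuffle (fun s c => shuffle (fun a b => T a b c) s) xs =
  shuffle (fun a s => shuffle (fun b c => T a b c) s) xs.
Proof.
elim: xs T => [//|x xs IH] T /=.
rewrite shuffleD IH -addrA; congr (_ + _).
under [X in _ = X]eq_shuffle do rewrite mulrDr -!shuffleZ.
rewrite shuffleD -!IH; congr (_ + _).
apply: eq_shuffle => s c; rewrite -shuffleZ; apply: eq_shuffle_size => a b <-.
by rewrite mulrA -exprD.
Qed.

Lemma shuffle_nil F xs :
  (forall a b, a != [::] -> F a b = 0) -> shuffle F xs = F [::] xs.
Proof.
elim: xs F => [//|x xs IH] F F0 /=.
rewrite shuffle0 ?add0r => [|a b]; last exact: F0.
by rewrite IH ?mul1r // => a b aN; rewrite F0 ?mulr0.
Qed.

Lemma shuffle_single x0 F xs :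
  (forall a b, size a != 1%N -> F a b = 0) ->
  shuffle F xs =
  \sum_(k < size xs)
    (-1) ^+ k * F [:: nth x0 xs k] (take k xs ++ drop k.+1 xs).
Proof.
elim: xs F => [|x xs IH] F F0 /=; first by rewrite big_ord0 F0.
(* If the first vector goes left, the left block is already full and all remaining vectors go
   right. *)
rewrite big_ord_recl /= drop0 mul1r shuffle_nil; last first.
  by move=> [|z a] b // _; apply: F0.
congr (_ + _); rewrite IH; last by move=> a b aN; rewrite F0 ?mulr0.
by apply: eq_bigr => k _ /=; rewrite expr1 exprS !mulN1r mulrN mulNr.
Qed.

(** This is the shape of a product whose left factor is a (1,1) double form. *)
Lemma shuffle_two_single x0 y0 (T : seq V -> seq V -> seq V -> seq V -> R)
    xs ys :
  (forall a b c d, (size a != 1%N) || (size c != 1%N) -> T a b c d = 0) ->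
  shuffle (fun a b => shuffle (fun c d => T a b c d) ys) xs =
  \sum_(k < size xs) \sum_(l < size ys)
    (-1) ^+ (k + l) * T [:: nth x0 xs k] (take k xs ++ drop k.+1 xs)
                        [:: nth y0 ys l] (take l ys ++ drop l.+1 ys).
Proof.
move=> T0; rewrite (@shuffle_single x0) => [|a b aN]; last first.
  by rewrite shuffle0 // => c d; rewrite T0 // aN.
apply: eq_bigr => k _; rewrite (@shuffle_single y0) => [|c d cN]; last first.
  by rewrite T0 // cN orbT.
by rewrite mulr_sumr; apply: eq_bigr => l _; rewrite mulrA exprD.
Qed.

End Shuffle.

(** * Multilinear and alternating functions on lists of vectors *)

Section Multilinear.
Context {R : realType} {V : vectType R}.
Implicit Types (x y u : V) (xs ys A B : seq V) (f : seq V -> R).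

Lemma multilinearD f A B x y : multilinear f ->
  f (A ++ (x + y) :: B) = f (A ++ x :: B) + f (A ++ y :: B).
Proof. by move=> /(_ A B 1 x y); rewrite scale1r mul1r. Qed.

Lemma multilinear0 f A B : multilinear f -> f (A ++ 0 :: B) = 0.
Proof.
move=> mf; apply: (addrI (f (A ++ 0 :: B))).
by rewrite -multilinearD // !addr0.
Qed.

Lemma multilinear_sum f n (k : 'I_n -> R) (u : 'I_n -> V) A B :
  multilinear f -> (forall i, f (A ++ u i :: B) = 0) ->
  f (A ++ (\sum_i k i *: u i) :: B) = 0.
Proof.
move=> mf f0; elim/big_rec: _ => [|i x _ fx]; first exact: multilinear0.
by rewrite mf f0 fx mulr0 addr0.
Qed.

Lemma multilinear_basis_eq0 n (e : n.-tuple V) f xs :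
  basis_of fullv e -> multilinear f ->
  (forall s : seq 'I_n, f (map (tnth e) s) = 0) -> f xs = 0.
Proof.
move=> eb mf f0; rewrite -[xs]/(map (tnth e) [::] ++ xs).
elim: xs [::] => [|x xs IH] s; first by rewrite cats0.
rewrite (coord_basis eb (memvf x)); apply: multilinear_sum => // i.
by rewrite -tnth_nth -cat_rcons -map_rcons.
Qed.

Lemma alternating_swap f A B x y : multilinear f -> alternating f ->
  f (A ++ x :: y :: B) = - f (A ++ y :: x :: B).
Proof.
move=> mf af; apply/eqP; rewrite -addr_eq0.
have f0 z : f (A ++ z :: z :: B) = 0.
  by apply: af; rewrite cat_uniq /= inE eqxx !andbF.
have := f0 (x + y); rewrite multilinearD // -!(cat_rcons _ A).
by rewrite !multilinearD // !cat_rcons !f0 add0r addr0 => ->.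
Qed.

Lemma alternating_move f A B C x : multilinear f -> alternating f ->
  f (A ++ x :: B ++ C) = (-1) ^+ size B * f (A ++ B ++ x :: C).
Proof.
move=> mf af; elim: B A => [|y B IH] A /=; first by rewrite mul1r.
rewrite alternating_swap // -cat_rcons IH cat_rcons.
by rewrite exprS mulN1r mulNr.
Qed.

(** The exponent is chosen before [f], [A] and [B], so that reordering both arguments of a double
    form in the same way produces the same sign twice. *)
Lemma alternating_perm xs ys : perm_eq xs ys ->
  exists s : nat, forall f A B, multilinear f -> alternating f ->
    f (A ++ xs ++ B) = (-1) ^+ s * f (A ++ ys ++ B).
Proof.
elim: xs ys => [|x xs IH] ys.
  by rewrite perm_sym => /perm_nilP ->; exists 0 => *; rewrite mul1r.
move=> pxy; have xys : x \in ys by rewrite -(perm_mem pxy) mem_head.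
case/splitPr: xys pxy => Y1 Y2 pxy.
have /IH[s fs] : perm_eq xs (Y1 ++ Y2).
  by rewrite -(perm_cons x) (perm_trans pxy) // perm_catC /= perm_cons perm_catC.
exists (s + size Y1)%N => f A B mf af.
rewrite /= -cat_rcons fs // cat_rcons -!catA /= alternating_move //.
by rewrite exprD mulrA.
Qed.

End Multilinear.

(** * Alternating sums and double counting over subsets *)

Lemma sumr_sub_sign (R : pzRingType) (T : finType) (A : {set T}) :
  A != set0 -> \sum_(Y : {set T} | Y \subset A) (-1) ^+ #|Y| = 0 :> R.
Proof.
case/set0Pn=> x xA; rewrite (bigID (fun Y : {set T} => x \in Y)) /=.
(* Adding [x] pairs the subsets avoiding [x] with those containing it, and the signs in each pair
   cancel. *)
rewrite (reindex_onto (fun Y => x |: Y) (fun Y => Y :\ x)) /=; last first.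
  by move=> Y /andP[_]; exact: setD1K.
rewrite (eq_bigl (fun Y : {set T} => (Y \subset A) && (x \notin Y))); last first.
  move=> Y; rewrite setU11 andbT subUset sub1set xA /=; congr (_ && _).
  apply/eqP/idP => [<-|xY]; first by rewrite !inE eqxx.
  by apply: setU1K.
rewrite -big_split big1 //= => Y /andP[_ xY].
by rewrite cardsU1 xY exprS mulN1r addNr.
Qed.

Section SubsetSums.
Context {R : comPzRingType} {T : finType}.
Implicit Types (X Y Z : {set T}) (f : {set T} -> R).

Lemma subset_card_eq Y Z : (Y \subset Z) && (#|Y| == #|Z|) = (Y == Z).
Proof.
apply/andP/eqP => [[sYZ /eqP c]|-> //].
by apply/eqP; rewrite eqEcard sYZ c leqnn.
Qed.

(** Double counting: [Y] arises once for each [z] in [Z :\: Y], hence [p.+1] times. *)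
Lemma sum_remove_subset f p Z :
  \sum_(z in Z) \sum_(Y : {set T} | (Y \subset Z :\ z) &&
                                   (#|Y| + p == #|Z :\ z|)%N) f Y =
  (\sum_(Y : {set T} | (Y \subset Z) && (#|Y| + p.+1 == #|Z|)%N) f Y) *+ p.+1.
Proof.
rewrite (exchange_big_dep (fun Y : {set T} =>
  (Y \subset Z) && (#|Y| + p.+1 == #|Z|)%N)) /=; last first.
  move=> z Y zZ; rewrite subsetD1 (cardsD1 z Z) zZ addnS add1n eqSS.
  by case/andP=> /andP[-> _] ->.
rewrite -sumrMnl; apply: eq_bigr => Y /andP[sYZ /eqP cY].
rewrite (eq_bigl (mem (Z :\: Y))) ?sumr_const /=.
  by rewrite cardsD (setIidPr sYZ) -cY addKn.
move=> z; rewrite !inE subsetD1 sYZ /=; case zZ: (z \in Z) => //=.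
  move: cY; rewrite (cardsD1 z Z) zZ addnS add1n => -[<-].
  by rewrite eqxx !andbT.
by rewrite andbF.
Qed.

(** Dually, [X] arises once for each [z] in [X :\: Z]. *)
Lemma sum_insert_superset f p Z :
  \sum_(z | z \notin Z) \sum_(X : {set T} | (z |: Z \subset X) &&
                                   (#|X| == #|z |: Z| + p)%N) f X =
  (\sum_(X : {set T} | (Z \subset X) && (#|X| == #|Z| + p.+1)%N) f X) *+ p.+1.
Proof.
rewrite (exchange_big_dep (fun X : {set T} =>
  (Z \subset X) && (#|X| == #|Z| + p.+1)%N)) /=; last first.
  move=> z X zZ; rewrite subUset cardsU1 zZ addnS add1n.
  by case/andP=> /andP[_ ->].
rewrite -sumrMnl; apply: eq_bigr => X /andP[sZX /eqP cX].
rewrite (eq_bigl (mem (X :\: Z))) ?sumr_const /=.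
  by rewrite cardsD (setIidPr sZX) cX addKn.
move=> z; rewrite !inE subUset sub1set sZX andbT cX cardsU1.
by case: (z \in Z) => //=; rewrite addnS add1n eqxx andbT.
Qed.

(** For fixed [X] and [Y], only $j=|X|-|Y|$ can contribute, and the other cardinality condition then
    reads $|X|+r=|Z|+q$, which does not involve [Y]. What remains is a signed sum over the subsets
    of [X :&: Z]. *)
Lemma sum_remove_insert_eq0 f q r Z :
  (forall X, f X != 0 ->
     (#|X| <= q)%N /\ ((#|X| + r = #|Z| + q)%N -> X :&: Z != set0)) ->
  \sum_(q - r <= j < q.+1) (-1) ^+ j *
    \sum_(Y : {set T} | (Y \subset Z) && (#|Y| + (j + r - q) == #|Z|)%N)
      \sum_(X : {set T} | (Y \subset X) && (#|X| == #|Y| + j)%N) f X = 0.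
Proof.
move=> fP.
pose c j Y X := [&& Y \subset Z, #|Y| + (j + r - q) == #|Z|, Y \subset X
  & #|X| == #|Y| + j]%N.
transitivity (\sum_(X : {set T}) \sum_(Y : {set T})
    \sum_(q - r <= j < q.+1) if c j Y X then (-1) ^+ j * f X else 0).
  under [RHS]eq_bigr do rewrite exchange_big.
  rewrite [RHS]exchange_big; apply: eq_bigr => j _.
  rewrite [RHS]exchange_big mulr_sumr [LHS]big_mkcond; apply: eq_bigr => Y _.
  rewrite /c; case: ifP => [/andP[-> ->]|ZY].
    by rewrite mulr_sumr big_mkcond.
  by rewrite big1 // => X _; rewrite andbA ZY.
apply: big1 => X _; have [->|/fP[Xq XZ]] := eqVneq (f X) 0.
  by rewrite big1 // => Y _; rewrite big1 // => j _; rewrite mulr0 if_same.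
transitivity (\sum_(Y : {set T} | Y \subset X :&: Z)
    if (#|X| + r == #|Z| + q)%N then (-1) ^+ #|X| * f X * (-1) ^+ #|Y| else 0).
  rewrite [RHS]big_mkcond; apply: eq_bigr => Y _.
  rewrite subsetI; case: ifP => [/andP[YX YZ]|YXZ]; last first.
    rewrite big1 // => j _; rewrite /c; case: (Y \subset Z) YXZ => //=.
    by rewrite andbT => ->; rewrite andbF.
  have := subset_leq_card YX; have := subset_leq_card YZ => YZc YXc.
  case: ifP => XrZq; last first.
    rewrite big_nat big1 // => j jqr; rewrite /c YX YZ /=.
    by case: ifP => // /andP[]; lia.
  rewrite (eq_big_nat _ _ (F2 := fun j => if j == (#|X| - #|Y|)%N
    then (-1) ^+ j * f X else 0)) => [|j jqr]; last first.
    by rewrite /c YX YZ /=; congr (if _ then _ else _); lia.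
  (* This index is in range: $|X|\le q$ gives the upper bound, and $|Y|\le|Z|=|X|+r-q$ the lower
     one. *)
  rewrite (bigD1_seq (#|X| - #|Y|)%N) ?iota_uniq ?mem_index_iota //=; last by lia.
  rewrite eqxx big1 ?addr0 => [|j /negPf -> //].
  by rewrite -signr_odd oddB // signr_addb !signr_odd mulrAC.
case: (altP eqP) => [/XZ XZ0|_]; last by rewrite big1.
by rewrite -mulr_sumr sumr_sub_sign ?mulr0.
Qed.

End SubsetSums.

(** * Algebra of double forms *)

Section DoubleForms.
Context {R : realType} {V : vectType R}.
Implicit Types (xs ys a b c d : seq V) (w t : dform V) (h : {symmetric V}).

(** Both sides sum over splittings of each argument into three blocks. Exchanging the shuffles of
    [xs] and [ys] allows [shuffleA] to be applied to one argument at a time. *)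
Lemma dform_mulA w t u :
  dform_mul w (dform_mul t u) = dform_mul (dform_mul w t) u.
Proof.
apply: val_inj; apply/funext => xs; apply/funext => ys; apply/esym.
pose T (a1 b1 a2 b2 a3 b3 : seq V) : R := w a1 b1 * t a2 b2 * u a3 b3.
transitivity (shuffle (fun s c => shuffle (fun a b => shuffle (fun s' d =>
    shuffle (fun a' b' => T a a' b b' c d) s') ys) s) xs).
  apply: eq_shuffle => s c; rewrite -shuffle_exchange.
  apply: eq_shuffle => s' d /=; rewrite mulrC -shuffleZ.
  apply: eq_shuffle => a b; rewrite -shuffleZ.
  by apply: eq_shuffle => a' b'; rewrite mulrC.
rewrite (shuffleA (fun a b c => shuffle (fun s' d =>
    shuffle (fun a' b' => T a a' b b' c d) s') ys)).
apply: eq_shuffle => a s.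
under eq_shuffle do rewrite (shuffleA (fun a' b' d => T a a' _ b' _ d)).
rewrite shuffle_exchange; apply: eq_shuffle => a' s' /=.
rewrite -shuffleZ; apply: eq_shuffle => b c; rewrite -shuffleZ.
by apply: eq_shuffle => b' d; rewrite mulrA.
Qed.

Lemma dform_mul1 w : dform_mul dform_one w = w.
Proof.
apply: val_inj; apply/funext => xs; apply/funext => ys.
rewrite /= /exterior_fun shuffle_nil => [|[//|x a] c _]; last first.
  by apply: shuffle0 => b d; rewrite mul0r.
by rewrite shuffle_nil => [|[//|y b] d _]; rewrite ?mul1r ?mul0r.
Qed.

(** Multiplication by $g^p$ thus becomes [p] successive multiplications by [g], each removing one
    index. *)
Lemma dform_exp_mul w t p :
  dform_mul (dform_exp w p) t = iter p (dform_mul w) t.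
Proof.
elim: p => [|p IH]; first exact: dform_mul1.
by rewrite /dform_exp /= -dform_mulA -/(dform_exp w p) IH.
Qed.

(** Each factor [h] consumes exactly one vector of each argument. *)
Lemma dform_exp_degree h q xs ys :
  (size xs != q) || (size ys != q) -> dform_exp (dform_of h) q xs ys = 0.
Proof.
elim: q => [|q IH] in xs ys *; first by case: xs ys => [|x xs] [|y ys].
move=> sq; rewrite /= /exterior_fun; transitivity (shuffle (fun _ _ : seq V => 0 : R) xs);
  last by rewrite shuffle0.
apply: eq_shuffle_size => a c ac.
transitivity (shuffle (fun _ _ : seq V => 0 : R) ys); last by rewrite shuffle0.
apply: eq_shuffle_size => a' c' ac'.
case: a a' ac ac' => [|x [|? ?]] [|y [|? ?]] //= ac ac'; rewrite ?mul0r //.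
by rewrite IH ?mulr0 //; move: sq; rewrite -ac -ac' !add1n !eqSS.
Qed.

(** * Values of double forms at vectors of an orthonormal family *)

Section Evaluation.
Context {n : nat} {e : n.-tuple V} {i0 : 'I_n}.
Implicit Types (s us vs : seq 'I_n) (Z X Y : {set 'I_n}).

(* The value of w at (e_Z /\ e_us, e_Z /\ e_vs). *)
Definition diag_coef us vs w Z : R :=
  w (map (tnth e) (enum Z ++ us)) (map (tnth e) (enum Z ++ vs)).

(* The sign of the reordering of s occurs twice. *)
Lemma diag_coef_perm us vs w Z s : perm_eq s (enum Z) ->
  w (map (tnth e) (s ++ us)) (map (tnth e) (s ++ vs)) = diag_coef us vs w Z.
Proof.
have [w1 w2 w3 w4] := dformP w.
move=> /(perm_map (tnth e)) /alternating_perm[k Hk].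
rewrite /diag_coef !map_cat.
rewrite (Hk _ [::] _ (w1 _) (w3 _)) (Hk _ [::] _ (w2 _) (w4 _)).
by rewrite mulrA -exprD addnn -mul2n exprM sqrrN !expr1n mul1r.
Qed.

Lemma diag_coef_nuniq us vs w Z :
  ~~ uniq (enum Z ++ us) || ~~ uniq (enum Z ++ vs) -> diag_coef us vs w Z = 0.
Proof.
have [_ _ w3 w4] := dformP w; rewrite /diag_coef.
case/orP=> nu; [apply: w3|apply: w4]; apply: contra nu; exact: map_uniq.
Qed.

(** The terms with [j] in [Z] repeat a vector. Those with [j] in [us] or [vs] vanish too, but are
    kept so that iteration ranges over all supersets of [Z]. *)
Lemma diag_coef_contraction us vs w Z :
  diag_coef us vs (contraction e w) Z =
  \sum_(j | j \notin Z) diag_coef us vs w (j |: Z).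
Proof.
have [_ _ w3 _] := dformP w.
rewrite [RHS]big_mkcond; apply: eq_bigr => j _.
case: ifPn => [jZ|]; last first.
  by rewrite negbK => jZ; rewrite w3 //= map_f // mem_cat mem_enum jZ.
rewrite -(@diag_coef_perm _ _ _ _ (j :: enum Z)) //.
apply: uniq_perm; rewrite ?enum_uniq //= ?mem_enum ?jZ ?enum_uniq //.
by move=> i; rewrite inE !mem_enum !inE.
Qed.

Lemma rem_nth_cat s us k : uniq s -> (k < size s)%N ->
  rem (nth i0 s k) s ++ us = take k (s ++ us) ++ drop k.+1 (s ++ us).
Proof.
move=> us_s ks; rewrite remE index_uniq // takel_cat ?(ltnW ks) // -catA.
congr (_ ++ _); rewrite drop_cat; case: ltnP => // sk.
rewrite drop_oversize //; have -> : (k.+1 - size s = 0)%N by apply/eqP.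
by rewrite drop0.
Qed.

Context {g : {symmetric V}}.
Hypothesis ge : forall i j, g (tnth e i) (tnth e j) = (i == j)%:R.

Lemma metric_mulE us vs w s :
  uniq (s ++ us) -> uniq (s ++ vs) -> ~~ has (mem us) vs ->
  dform_mul (dform_of g) w (map (tnth e) (s ++ us)) (map (tnth e) (s ++ vs)) =
  \sum_(z <- s) w (map (tnth e) (rem z s ++ us)) (map (tnth e) (rem z s ++ vs)).
Proof.
move=> Us Vs UV; have s_uniq : uniq s by move: Us; rewrite cat_uniq => /andP[].
rewrite /= /exterior_fun (shuffle_two_single 0 0) => [|[|? [|? ?]] ? [|? [|? ?]] ?];
  rewrite ?mul0r //=.
rewrite !size_map !size_cat big_split_ord /= [X in _ + X]big1 ?addr0.
  rewrite (big_nth i0) big_mkord; apply: eq_bigr => k _.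
  (* By orthonormality and distinctness, position [k] of [s] pairs only with itself, and the sign is
     $(-1)^{2k}=1$. *)
  rewrite (bigD1 (lshift (size vs) k)) //= big1 ?addr0 => [|l lk].
    rewrite addnn -mul2n exprM sqrrN !expr1n mul1r.
    have kU : (k < size (s ++ us))%N by rewrite size_cat ltn_addr.
    have kV : (k < size (s ++ vs))%N by rewrite size_cat ltn_addr.
    rewrite !(nth_map i0) // !nth_cat ltn_ord /bilin_fun ge eqxx mul1r.
    by rewrite -!map_take -!map_drop -!map_cat -!rem_nth_cat.
  have kU : (k < size (s ++ us))%N by rewrite size_cat ltn_addr.
  have kV : (k < size (s ++ vs))%N by rewrite size_cat ltn_addr.
  have lV : (l < size (s ++ vs))%N by rewrite size_cat.
  rewrite !(nth_map i0) // /bilin_fun ge.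
  have -> : nth i0 (s ++ us) k = nth i0 (s ++ vs) k by rewrite !nth_cat ltn_ord.
  rewrite nth_uniq //; move: lk; rewrite -val_eqE /= eq_sym => /negPf ->.
  by rewrite mul0r mulr0.
(* An index of [us] occurs neither in [s] nor in [vs], so it pairs with nothing. *)
move=> k _; rewrite big1 // => l _.
have kU : (size s + k < size (s ++ us))%N by rewrite size_cat ltn_add2l.
have lV : (l < size (s ++ vs))%N by rewrite size_cat.
rewrite !(nth_map i0) // /bilin_fun ge /= [_ == _]negbTE ?mul0r ?mulr0 //.
apply: contraTneq (mem_nth i0 lV) => <-.
rewrite nth_cat ltnNge leq_addr addKn /= mem_cat negb_or.
have ku : nth i0 us k \in us by exact: mem_nth.
move: Us; rewrite cat_uniq => /and3P[_ /hasPn/(_ _ ku) -> _] /=.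
by move: UV; rewrite has_sym => /hasPn/(_ _ ku).
Qed.

Lemma diag_coef_metric us vs w Z :
  uniq (enum Z ++ us) -> uniq (enum Z ++ vs) -> ~~ has (mem us) vs ->
  diag_coef us vs (dform_mul (dform_of g) w) Z =
  \sum_(z in Z) diag_coef us vs w (Z :\ z).
Proof.
move=> Us Vs UV; rewrite /diag_coef metric_mulE // -[RHS]big_enum.
apply: eq_bigr => z _; apply: diag_coef_perm.
apply: uniq_perm; rewrite ?rem_uniq ?enum_uniq // => x.
by rewrite mem_rem_uniq ?enum_uniq // inE /= !mem_enum !inE.
Qed.

(** The factorial counts the orders in which the [p] indices of [Z :\: Y] are removed. *)
Lemma diag_coef_metric_iter us vs w p Z :
  uniq (enum Z ++ us) -> uniq (enum Z ++ vs) -> ~~ has (mem us) vs ->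
  diag_coef us vs (iter p (dform_mul (dform_of g)) w) Z =
  p`!%:R * \sum_(Y : {set 'I_n} | (Y \subset Z) && (#|Y| + p == #|Z|)%N)
    diag_coef us vs w Y.
Proof.
move=> Us Vs UV; elim: p => [|p IH] in Z Us Vs *.
  rewrite fact0 mul1r (big_pred1 Z) // => Y.
  by rewrite addn0 subset_card_eq.
rewrite iterS diag_coef_metric //.
under eq_bigr => z zZ.
  have sub_uniq ts : uniq (enum Z ++ ts) -> uniq (enum (Z :\ z) ++ ts).
    rewrite !cat_uniq !enum_uniq /= => /andP[nh ->]; rewrite andbT.
    by apply: contra nh; apply: sub_has => x; rewrite /= !mem_enum => /setD1P[].
  rewrite IH; [|exact: sub_uniq|exact: sub_uniq].
  over.
by rewrite -mulr_sumr sum_remove_subset factS natrM -mulrA mulrnAr !mulr_natl.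
Qed.

Lemma diag_coef_contraction_iter us vs w j Z :
  diag_coef us vs (iter j (contraction e) w) Z =
  j`!%:R * \sum_(X : {set 'I_n} | (Z \subset X) && (#|X| == #|Z| + j)%N)
    diag_coef us vs w X.
Proof.
elim: j Z => [|j IH] Z.
  rewrite fact0 mul1r (big_pred1 Z) // => X.
  by rewrite addn0 [#|X| == _]eq_sym subset_card_eq eq_sym.
rewrite iterS diag_coef_contraction.
under eq_bigr do rewrite IH.
by rewrite -mulr_sumr sum_insert_superset factS natrM -mulrA mulrnAr !mulr_natl.
Qed.

Lemma diag_coef_sum us vs (I : Type) (js : seq I) (k : I -> R)
    (w : I -> dform V) Z :
  diag_coef us vs (\sum_(j <- js) k j *: w j) Z =
  \sum_(j <- js) k j * diag_coef us vs (w j) Z.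
Proof. by elim/big_rec2: _ => // j x t _ <-. Qed.

Lemma diag_coef_degree_meet us vs h q r X Z : (n < q + r)%N ->
  uniq (enum Z ++ us) -> uniq (enum Z ++ vs) -> ~~ has (mem us) vs ->
  diag_coef us vs (dform_exp (dform_of h) q) X != 0 ->
  (#|X| <= q)%N /\ ((#|X| + r = #|Z| + q)%N -> X :&: Z != set0).
Proof.
move=> nqr UZ VZ UV fX.
have /eqP sU : size (enum X ++ us) == q.
  apply: contraNT fX => sN.
  by rewrite /diag_coef dform_exp_degree // !size_map sN.
have /eqP sV : size (enum X ++ vs) == q.
  apply: contraNT fX => sN.
  by rewrite /diag_coef dform_exp_degree // !size_map sN orbT.
have UX : uniq (enum X ++ us).
  by apply: contraNT fX => nu; rewrite diag_coef_nuniq // nu.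
have VX : uniq (enum X ++ vs).
  by apply: contraNT fX => nu; rewrite diag_coef_nuniq // nu orbT.
rewrite size_cat -cardE in sU; rewrite size_cat -cardE in sV.
split=> [|cXZ]; first by rewrite -sU leq_addr.
apply/negP => /eqP XZ.
have : uniq (enum (X :|: Z) ++ (us ++ vs)).
  move: UX VX UZ VZ; rewrite !cat_uniq !enum_uniq /=.
  move=> /andP[uX ->] /andP[vX ->] /andP[uZ _] /andP[vZ _].
  rewrite has_cat negb_or UV /= andbT.
  apply/andP; split; rewrite -!all_predC; apply/allP => x xs /=;
    rewrite mem_enum inE negb_or.
    move: (hasPn uX _ xs) (hasPn uZ _ xs).
    by rewrite /= !mem_enum => -> ->.
  move: (hasPn vX _ xs) (hasPn vZ _ xs).
  by rewrite /= !mem_enum => -> ->.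
(* From $|X|+|us|=q$ and $|X|+r=|Z|+q$ follows $r=|Z|+|us|$; with $|X|+|vs|=q$ the list has $q+r>n$
   distinct entries. *)
move=> /card_uniqP; rewrite !size_cat -cardE cardsU XZ cards0 subn0 => c.
have := max_card (mem (enum (X :|: Z) ++ (us ++ vs))).
by rewrite c card_ord; lia.
Qed.

Lemma diag_coef_s_form us vs h q r Z : (n < q + r)%N ->
  uniq (enum Z ++ us) -> uniq (enum Z ++ vs) -> ~~ has (mem us) vs ->
  diag_coef us vs (s_form e g h r q) Z = 0.
Proof.
move=> nqr UZ VZ UV; rewrite /s_form diag_coef_sum.
under eq_bigr => j _.
  rewrite dform_exp_mul diag_coef_metric_iter //.
  under eq_bigr do rewrite diag_coef_contraction_iter.
  rewrite -mulr_sumr.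
  set S := \sum_(Y | _) _.
  (* The factorials from the iterations cancel those in the definition, leaving only $(-1)^j$ to
     depend on [j] outside [S]. *)
  have -> : (-1) ^+ (j + q) / (j`! * q`! * (j + r - q)`!)%:R *
      ((j + r - q)`!%:R * (j`!%:R * S)) =
      ((-1) ^+ q / q`!%:R) * ((-1) ^+ j * S) :> R.
    have f0 k : k`!%:R != 0 :> R by rewrite pnatr_eq0 -lt0n fact_gt0.
    by rewrite !natrM exprD; field; rewrite !f0.
  rewrite /S; over.
rewrite -mulr_sumr sum_remove_insert_eq0 ?mulr0 // => X fX.
exact: (diag_coef_degree_meet nqr UZ VZ UV fX).
Qed.

Lemma s_form_basis_eq0 h q r (s s' : seq 'I_n) : (n < q + r)%N ->
  s_form e g h r q (map (tnth e) s) (map (tnth e) s') = 0.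
Proof.
move=> nqr; have [w1 w2 w3 w4] := dformP (s_form e g h r q).
have [us_s|nu] := boolP (uniq s); last first.
  by apply: w3; apply: contra nu; exact: map_uniq.
have [us_s'|nu] := boolP (uniq s'); last first.
  by apply: w4; apply: contra nu; exact: map_uniq.
(* [Z] holds the common indices, [us] and [vs] those proper to [s] and [s']; up to sign, the value
   sought is a [diag_coef]. *)
pose Z := [set i in s | i \in s'].
pose us := [seq i <- s | i \notin s']; pose vs := [seq i <- s' | i \notin s].
have UZ : uniq (enum Z ++ us).
  rewrite cat_uniq enum_uniq filter_uniq // andbT; apply/hasPn => x.
  by rewrite mem_filter /= mem_enum inE => /andP[/negPf -> _]; rewrite andbF.
have VZ : uniq (enum Z ++ vs).
  rewrite cat_uniq enum_uniq filter_uniq // andbT; apply/hasPn => x.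
  by rewrite mem_filter /= mem_enum inE => /andP[/negPf -> _].
have UV : ~~ has (mem us) vs.
  apply/hasPn => x; rewrite !mem_filter /= mem_filter => /andP[/negPf -> _].
  by rewrite andbF.
have [|k Hk] := @alternating_perm R V (map (tnth e) s)
    (map (tnth e) (enum Z ++ us)).
  apply/perm_map/uniq_perm => // x.
  rewrite mem_cat mem_enum mem_filter inE.
  by case: (x \in s); case: (x \in s').
have [|l Hl] := @alternating_perm R V (map (tnth e) s')
    (map (tnth e) (enum Z ++ vs)).
  apply/perm_map/uniq_perm => // x.
  rewrite mem_cat mem_enum mem_filter inE.
  by case: (x \in s); case: (x \in s').
have := Hk _ [::] [::] (w1 (map (tnth e) s')) (w3 _).
rewrite /= !cats0 => ->.
have := Hl _ [::] [::] (w2 (map (tnth e) (enum Z ++ us))) (w4 _).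
have := diag_coef_s_form h nqr UZ VZ UV; rewrite /diag_coef => s0.
by rewrite /= !cats0 s0 mulr0 => ->; rewrite mulr0.
Qed.

Lemma s_form_eq0 h q r : basis_of fullv e -> (n < q + r)%N ->
  s_form e g h r q = 0.
Proof.
move=> eb nqr; have [w1 w2 _ _] := dformP (s_form e g h r q).
apply: val_inj; apply/funext => xs; apply/funext => ys.
apply: (multilinear_basis_eq0 xs eb (w1 ys)) => s.
apply: (multilinear_basis_eq0 ys eb (w2 _)) => s'.
exact: s_form_basis_eq0.
Qed.

End Evaluation.
End DoubleForms.

(** * Orthonormal bases and the vanishing theorem *)

Lemma orthonormal_tnth (R : realType) (V : vectType R) n (g : {symmetric V})
    (e : n.-tuple V) i j :
  orthonormal g e -> g (tnth e i) (tnth e j) = (i == j)%:R.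
Proof.
(* [pair_ortho_rec] compares each vector with later ones only; the other order follows from the
   symmetry of [g]. *)
have ortho_lt s k l : pair_ortho_rec g s -> (k < l < size s)%N ->
    g s`_k s`_l = 0.
  elim: s k l => [|x s IH] k [|l]; rewrite ?ltn0 ?andbF //= => /andP[xs os].
  case: k => [|k] kl; last exact: IH.
  by move: xs; rewrite andbT => /allP xs; apply/eqP/xs/mem_nth.
case/andP=> /allP e1 eo; have [<-|ij] := eqVneq.
  by apply/eqP/e1; exact: mem_tnth.
rewrite !(tnth_nth 0); case: (ltngtP i j) => [lij|lji|/val_inj eij].
- by rewrite ortho_lt // lij size_tuple ltn_ord.
- by rewrite hermC mul1r ortho_lt // lji size_tuple ltn_ord.
- by rewrite eij eqxx in ij.
Qed.

Theorem theorem2p11 (R : realType) (V : vectType R) (n : nat)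
  (hn : (1 <= n)%N) (hV : \dim (fullv : {vspace V}) = n)
  (g : {dot V for idfun}) (h : {symmetric V})
  (e : n.-tuple V) (heb : basis_of fullv e) (heo : orthonormal g e)
  (i r : nat) (hir : (1 <= i + 1 <= r)%N) (hrn : (r <= n - i)%N) :
  s_form e g h r (n - i) = 0.
Proof.
(* The index 0, available as $n\ge1$, is the default value for [nth]. Since $1\le r\le n-i$, the
   subtraction does not truncate, and $i+1\le r$ gives $n<(n-i)+r$. *)
apply: (s_form_eq0 (i0 := Ordinal hn)) => //; last by lia.
by move=> k l; exact: orthonormal_tnth.
Qed.
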